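(* Let $k\geqslant 2$ and $n\geqslant k$ be integers, and let $P_n$ be the path graph on $n$ vertices. Then $$\gamma_{k\text{-SRD}}(P_n)=\left\lceil\frac{2k}{2k+1}\,n\right\rceil.$$
   Context: $P_n$ has vertex set $\{a_1,\ldots,a_n\}$ and edge set $\{a_ia_{i+1} : i\in\{1,\ldots,n-1\}\}$. All graphs are finite, simple and undirected; $N(v)$ denotes the set of neighbors of $v$ and $\Delta(G)$ the maximum degree. Let $k\geqslant 1$ be an integer with $|V(G)|\geqslant k$. An attack pattern is a set $P\subseteq V(G)$ with $|P|=k$. A function $f:V(G)\to\{0,1,\ldots,\min(\Delta(G),k)+1\}$ is a proper $k$-SRD ($k$-strong Roman domination) function if for each attack pattern $P$ every vertex $u\in P$ with $f(u)=0$ can be defended by a neighboring vertex, where each vertex $v$ with $f(v)\geqslant 2$ can defend at most $f(v)-1$ of its neighbors in $P$ labeled 0 (and vertices with label $\leqslant 1$ defend no other vertex). That is, for each $P$ there is a map $\delta_P:\{u\in P : f(u)=0\}\to V(G)$ (which may depend on $P$) such that $\delta_P(u)\in N(u)$ and $f(\delta_P(u))\geqslant 2$ for all $u$ in its domain, and $|\delta_P^{-1}(v)|\leqslant f(v)-1$ for every $v$ with $f(v)\geqslant 2$. The weight is $\omega(f)=\sum_{v\in V(G)}f(v)$, and the $k$-SRD number is $\gamma_{k\text{-SRD}}(G)=\min\{\omega(f) : f \text{ is a proper } k\text{-SRD function on } G\}$. *)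

(* Defs.v *)
From HB Require Import structures.
From mathcomp Require Import all_boot all_order all_algebra.

Set Implicit Arguments.
Unset Strict Implicit.
Unset Printing Implicit Defensive.

(* Finite simple undirected graphs. *)
Record sgraph := SGraph {
  vertex :> finType;
  adj : rel vertex;
  adj_sym : symmetric adj;
  adj_irr : irreflexive adj }.

Definition neighbors (G : sgraph) (v : G) : {set G} := [set u | adj v u].

Definition max_degree (G : sgraph) : nat := \max_(v : G) #|neighbors v|.

(* Labels range over {0, ..., min(Delta(G), k) + 1}. *)
Definition labeling (G : sgraph) (k : nat) : finType :=
  {ffun G -> 'I_(minn (max_degree G) k).+2}.

Definition weight (G : sgraph) (k : nat) (f : labeling G k) : nat :=
  \sum_(v : G) f v.

Definition zeros (G : sgraph) (k : nat) (f : labeling G k) (P : {set G}) :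
  {set G} := [set u in P | f u == 0 :> nat].

(* delta encodes a map zeros f P -> V(G): its values outside zeros f P are
   irrelevant. *)
Definition defends (G : sgraph) (k : nat) (f : labeling G k) (P : {set G})
    (delta : {ffun G -> G}) : bool :=
  [forall u in zeros f P, (delta u \in neighbors u) && (2 <= f (delta u))]
  && [forall v, (2 <= f v) ==>
        (#|[set u in zeros f P | delta u == v]| <= f v - 1)].

Definition proper_kSRD (G : sgraph) (k : nat) (f : labeling G k) : bool :=
  [forall P : {set G}, (#|P| == k) ==>
     [exists delta : {ffun G -> G}, defends f P delta]].

Definition all_one (G : sgraph) (k : nat) : labeling G k :=
  [ffun => Ordinal (isT : 1 < (minn (max_degree G) k).+2)].

Lemma all_one_proper (G : sgraph) (k : nat) : proper_kSRD (all_one G k).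
Proof.
apply/forallP => P; apply/implyP => _; apply/existsP; exists (finfun id).
apply/andP; split; first by apply/forallP => u; rewrite !inE !ffunE andbF.
by apply/forallP => v; rewrite ffunE.
Qed.

(* By all_one_proper, the minimum below is over a nonempty set, so it does not
   depend on the base point all_one. *)
Definition gamma_kSRD (k : nat) (G : sgraph) : nat :=
  weight [arg min_(f < all_one G k | proper_kSRD f) weight f].

Lemma gamma_kSRD_min (k : nat) (G : sgraph) :
  (exists2 f : labeling G k, proper_kSRD f & weight f = gamma_kSRD k G) /\
  (forall f : labeling G k, proper_kSRD f -> gamma_kSRD k G <= weight f).
Proof.
rewrite /gamma_kSRD; case: arg_minnP => [|f fP fmin]; first exact: all_one_proper.
by split=> //; exists f.
Qed.

(* The vertex a_(i+1) is represented by i : 'I_n. *)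
Definition path_adj (n : nat) : rel 'I_n :=
  fun i j => (i.+1 == j :> nat) || (j.+1 == i :> nat).

Lemma path_adj_sym (n : nat) : symmetric (@path_adj n).
Proof. by move=> i j; rewrite /path_adj orbC. Qed.

Lemma path_adj_irr (n : nat) : irreflexive (@path_adj n).
Proof. by move=> i; rewrite /path_adj orbb gtn_eqF. Qed.

Definition path_graph (n : nat) : sgraph :=
  SGraph (@path_adj_sym n) (@path_adj_irr n).

(* Main.v *)
(** Write D for the excess of the number of vertices over the weight, so that D
    is the number of zeros minus the total defence capacity of the labels >= 2.
    Cut the path wherever two consecutive vertices are not a zero next to a
    label >= 2.  Each piece alternates between zeros and labels >= 2, so it
    contributes at most 1 to D; a piece with at most k zeros can be attacked at
    all its zeros and must defend itself, so it contributes at most 0.  Hence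
    only pieces with at least 2k+1 vertices contribute, and D <= n/(2k+1).
    Conversely a block 0 2 0 2 ... 2 0 with 2k+1 vertices has weight 2k, and
    k attacks always spare one of its zeros: the zeros to the left of a spared
    one are defended from their right, the others from their left. *)
Require Import Defs.
From mathcomp Require Import all_boot all_order all_algebra.
From mathcomp Require Import zify.

Set Implicit Arguments.
Unset Strict Implicit.
Unset Printing Implicit Defensive.

Import GRing.Theory Num.Theory.

(** * Attacked zeros and the defence capacity around them *)

Lemma exists_superset_card (T : finType) (A : {set T}) (k : nat) :
  #|A| <= k <= #|T| -> exists2 B : {set T}, A \subset B & #|B| = k.
Proof.
elim: k => [|k IH] /andP[lAk lkT]; first by exists A => //; lia.
have [cA|neA] := eqVneq #|A| k.+1; first by exists A.
have [|B sAB cB] := IH; first lia.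
have [x] : exists x, x \in ~: B.
  by apply/set0Pn; rewrite -card_gt0; have := cardsC B; lia.
rewrite inE => xB; exists (x |: B); first exact: subset_trans sAB (subsetUr _ _).
by rewrite cardsU1 xB cB.
Qed.

(** Padding [S] to an attack pattern of exactly [k] vertices yields a defence map; it sends [S] into
    [T], with at most [f v - 1] vertices of [S] over each [v]. *)
Lemma card_zeros_le_capacity (G : sgraph) (k : nat) (f : labeling G k)
    (S T : {set G}) :
  proper_kSRD f -> k <= #|G| -> #|S| <= k ->
  (forall u, u \in S -> f u = 0 :> nat) ->
  (forall u v, u \in S -> adj u v -> 2 <= f v -> v \in T) ->
  #|S| <= \sum_(v in T) (f v - 1).
Proof.
move=> /forallP fP kG Sk S0 ST.
have [|P sSP cP] := @exists_superset_card _ S k; first by rewrite Sk.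
have /implyP/(_ (introT eqP cP))/existsP[delta /andP[/forall_inP d1 /forall_inP d2]]
  := fP P.
have SZ u : u \in S -> u \in zeros f P.
  by move=> uS; rewrite inE (subsetP sSP _ uS) S0.
have dT u : u \in S -> (delta u \in T) && (2 <= f (delta u)).
  move=> uS; have /andP[] := d1 _ (SZ _ uS); rewrite inE => uv f2.
  by rewrite f2 (ST u).
rewrite -sum1_card (partition_big delta (mem T)) /=; last first.
  by move=> u /dT/andP[].
apply: leq_sum => v vT; rewrite sum1dep_card.
have [h|h] := leqP 2 (f v).
  apply: leq_trans (d2 v h); apply: subset_leq_card; apply/subsetP => u.
  by rewrite !inE => /andP[/SZ] /[!inE] -> ->.
(* A label at most 1 defends nothing, so its fibre is empty. *)
rewrite (_ : [set _ | _] = set0) ?cards0 //; apply/setP => u; rewrite !inE.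
by apply/andP => -[/dT/andP[_ +] /eqP e]; rewrite e; lia.
Qed.

(** * Cutting a label sequence into alternating pieces *)

Definition link (g : nat -> nat) (i : nat) : bool :=
  ((g i == 0) && (2 <= g i.+1)) || ((2 <= g i) && (g i.+1 == 0)).

Definition zero_count (g : nat -> nat) (a b : nat) : nat :=
  \sum_(a <= i < b) (g i == 0).

Definition capacity (g : nat -> nat) (a b : nat) : nat :=
  \sum_(a <= i < b) (g i - 1).

(** Termwise, [g i + (g i == 0) = (g i - 1) + 1], the truncated subtraction absorbing the label 0.
    Hence zeros minus capacity equals length minus weight. *)
Lemma sum_zero_count (g : nat -> nat) (a b : nat) :
  \sum_(a <= i < b) g i + zero_count g a b = capacity g a b + (b - a).
Proof.
rewrite -[b - a]muln1 -sum_nat_const_nat -!big_split /=.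
by apply: eq_bigr => i _; lia.
Qed.

(** The term for the last vertex carries the induction on [L]: appending a zero raises it to 1,
    appending a label >= 2 returns it to 0 and adds at least 1 to the capacity. *)
Lemma linked_zero_count (g : nat -> nat) (a L : nat) :
  (forall i, a <= i < a + L -> link g i) ->
  zero_count g a (a + L).+1 <= capacity g a (a + L).+1 + (g (a + L) == 0) /\
  2 * zero_count g a (a + L).+1 <= L.+1 + (g (a + L) == 0).
Proof.
rewrite /zero_count /capacity; elim: L => [|L IH] lnk.
  by rewrite addn0 !big_nat1; lia.
have [|IH1 IH2] := IH; first by move=> i hi; apply: lnk; lia.
have /lnk : a <= a + L < a + L.+1 by lia.
rewrite /link addnS !(@big_nat_recr _ _ _ (a + L).+1) /=; try lia.
Qed.

Definition cut (g : nat -> nat) (m : nat) : bool :=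
  (m == 0) || ~~ link g m.-1.

Lemma last_cut (g : nat -> nat) (m : nat) : 0 < m ->
  exists a L, [/\ m = (a + L).+1, cut g a & forall i, a <= i < a + L -> link g i].
Proof.
move=> m0; have ex0 : exists a, (a < m) && cut g a by exists 0; rewrite m0.
case: (ex_maxnP (m := m) ex0) => [i /andP[] /ltnW //|a /andP[am ca] amax].
exists a, (m - a.+1); split => [||i hi] //; first lia.
apply/negPn/negP => nl.
by have := amax i.+1; rewrite /cut /= nl andbT => /(_ ltac:(lia)); lia.
Qed.

Lemma sum_ge_cut (g : nat -> nat) (k m : nat) :
  (forall a b, a <= b <= m -> cut g a -> cut g b -> zero_count g a b <= k ->
     zero_count g a b <= capacity g a b) ->
  cut g m -> m <= \sum_(0 <= i < m) g i + m %/ (2 * k + 1).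
Proof.
elim/ltn_ind: m => m IH hall cm.
have [->//|] := posnP m; move=> /(last_cut g) [a [L [em ca lnk]]].
have Ha : a <= \sum_(0 <= i < a) g i + a %/ (2 * k + 1).
  by apply: IH => //; [lia|move=> a' b' h; apply: hall; lia].
have [h1 h2] := linked_zero_count lnk; rewrite -em in h1 h2.
have := sum_zero_count g a m.
rewrite (@big_cat_nat _ _ _ a 0 m) //=; last lia.
(* By [h2] a short last piece has at most [k] zeros, so [hall] applies to it. A long one has excess
   at most 1 by [h1], and it raises the quotient by at least 1. *)
have [short|long] := ltnP (m - a) (2 * k + 1).
  have := hall a m ltac:(lia) ca cm ltac:(lia).
  by have := leq_div2r (2 * k + 1) (ltac:(lia) : a <= m); lia.
have : (a + (2 * k + 1)) %/ (2 * k + 1) <= m %/ (2 * k + 1).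
  by apply: leq_div2r; lia.
by rewrite divnDr ?dvdnn // divnn; lia.
Qed.

(** * The lower bound on the path *)

Lemma weight_path_ge (k n : nat) (f : labeling (path_graph n) k) :
  k <= n -> proper_kSRD f -> n <= weight f + n %/ (2 * k + 1).
Proof.
move=> kn fP.
(* The value 1 beyond the path is neither a zero nor a defender, so position [n] is a cut. *)
pose g i := if insub i is Some j then nat_of_ord (f (j : 'I_n)) else 1.
have gE (j : 'I_n) : g j = f j by rewrite /g valK.
have gN i : n <= i -> g i = 1 by move=> h; rewrite /g insubN // -leqNgt.
have -> : weight f = \sum_(0 <= i < n) g i.
  by rewrite big_mkord; apply: eq_bigr => i _; rewrite gE.
apply: sum_ge_cut => [a b /andP[ab bn] ca cb|]; last first.
  rewrite /cut /link; have [//|n0] := eqVneq n 0.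
  by rewrite prednK ?lt0n // (gN n) ?leqnn ?andbF.
pose I := [set i : 'I_n | a <= i < b].
have sumI (F : nat -> nat) : \sum_(a <= i < b) F i = \sum_(i in I) F i.
  rewrite (@big_nat_widenl _ _ _ a 0) // (@big_nat_widen _ _ _ 0 b n) // big_mkord.
  by apply: eq_bigl => i; rewrite inE.
have zE : zero_count g a b = #|[set i in I | f i == 0 :> nat]|.
  rewrite /zero_count sumI -sum1_card big_mkcond [RHS]big_mkcond /=.
  by apply: eq_bigr => i _; rewrite !inE gE; case: (_ <= _ < _) => //=; case: eqP.
rewrite zE /capacity sumI => Zk.
rewrite (eq_bigr (fun i => f i - 1)); last by move=> i _; rewrite gE.
apply: card_zeros_le_capacity => //; first by rewrite card_ord.
  by move=> u; rewrite inE => /andP[_ /eqP].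
(* An edge from a zero to a label >= 2 is a link, so it crosses neither of the cuts [a] and [b]. *)
move=> u v; rewrite !inE => /andP[/andP[au ub] /eqP u0] /orP[] /eqP uv f2.
- apply/andP; split; first lia.
  move: cb; rewrite ltn_neqAle -uv ub andbT /cut => cb; apply/eqP => eb.
  by move: cb; rewrite -eb /= /link uv !gE u0 f2.
- apply/andP; split; last lia.
  rewrite leqNgt; apply/negP => va; have ea : a = v.+1 by lia.
  by move: ca; rewrite /cut ea /= /link uv !gE u0 f2 orbT.
Qed.

(** * The block labelling and its weight *)

Definition block_label (k n i : nat) : nat :=
  if i %/ (2 * k + 1) < n %/ (2 * k + 1) then
    (if odd (i %% (2 * k + 1)) then 2 else 0)
  else 1.

Lemma sum_alternating (k : nat) :
  \sum_(0 <= i < 2 * k + 1) (if odd i then 2 else 0) = 2 * k.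
Proof.
elim: k => [|k IH]; first by rewrite big_nat1.
rewrite (_ : 2 * k.+1 + 1 = (2 * k + 1).+2); last lia.
by rewrite 2?big_nat_recr //= IH addn1 /= mul2n odd_double /=; lia.
Qed.

(** Each full block weighs one less than its length; the remaining vertices weigh 1 each. *)
Lemma sum_block_label (k n : nat) :
  \sum_(0 <= i < n) block_label k n i + n %/ (2 * k + 1) = n.
Proof.
set d := 2 * k + 1; set q0 := n %/ d.
have dgt0 : 0 < d by lia.
have H q : q <= q0 -> \sum_(0 <= i < q * d) block_label k n i = 2 * k * q.
  elim: q => [|q IH] qq; first by rewrite mul0n big_geq // muln0.
  rewrite (@big_cat_nat _ _ _ (q * d)) ?leq_mul //= IH ?(ltnW qq) //.
  rewrite mulnS addnC -{1}[q * d]add0n mulSn big_addn addnK; congr (_ + _).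
  rewrite -(sum_alternating k) big_nat_cond [RHS]big_nat_cond.
  apply: eq_bigr => i /andP[/andP[_ ltid] _].
  by rewrite /block_label -/d addnC divnMDl // modnMDl divn_small // addn0 qq modn_small.
have nE : n = q0 * d + n %% d by rewrite /q0 -divn_eq.
rewrite (@big_cat_nat _ _ _ (q0 * d)) ?H //=; last lia.
rewrite (eq_big_nat _ _ (F2 := fun=> 1)); last first.
  move=> i /andP[qi _]; rewrite /block_label -/d -/q0 ltnNge.
  by rewrite leq_divRL // qi.
by rewrite sum_nat_const_nat; nia.
Qed.

Lemma block_label_le2 (k n i : nat) : block_label k n i <= 2.
Proof. by rewrite /block_label; case: ifP => // _; case: ifP. Qed.

(** Inside one block, adjacent positions have consecutive residues, hence of opposite parity. *)
Lemma block_label_adjacent (k n i j : nat) :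
  (i.+1 == j) || (j.+1 == i) -> j %/ (2 * k + 1) = i %/ (2 * k + 1) ->
  block_label k n i = 0 -> block_label k n j = 2.
Proof.
rewrite /block_label => ij e; rewrite e; case: ifP => // _; case: ifP => // ei _.
suff -> : odd (j %% (2 * k + 1)) by [].
have := divn_eq i (2 * k + 1); have := divn_eq j (2 * k + 1); rewrite e.
move: (_ * _) (_ %% _) (_ %% _) ei ij => a b c ec ij ei ej.
by have [] : b = c.+1 \/ c = b.+1; lia.
Qed.

Lemma divn_between (d i j l : nat) :
  i <= j <= l -> l %/ d = i %/ d -> j %/ d = i %/ d.
Proof.
by move=> /andP[ij jl] e; apply/eqP; rewrite eqn_leq -{1}e !leq_div2r.
Qed.

(** * Defending the block labelling *)

Lemma max_degree_path_gt0 (n : nat) : 1 < n -> 0 < max_degree (path_graph n).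
Proof.
case: n => [|[|n]] // _.
apply: leq_trans (leq_bigmax (ord0 : path_graph n.+2)).
by apply/card_gt0P; exists (lift ord0 ord0); rewrite inE.
Qed.

(** A block has [k + 1] zeros, at the even offsets, and only [k] vertices are attacked. Taking [u]
    as the first vertex of its block puts the spared zero at or after [u]. *)
Lemma block_zero_spared (k n : nat) (P : {set 'I_n}) (u : 'I_n) :
  #|P| = k -> block_label k n u = 0 -> u %% (2 * k + 1) = 0 ->
  exists w : 'I_n,
    [&& u <= w, w %/ (2 * k + 1) == u %/ (2 * k + 1),
        block_label k n w == 0 & w \notin P].
Proof.
set d := 2 * k + 1 => cP u0 ud.
have dgt0 : 0 < d by lia.
have ltq : u %/ d < n %/ d by move: u0; rewrite /block_label -/d; case: ifP.
have jlt (j : 'I_k.+1) : 2 * j < d by have := ltn_ord j; lia.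
have wlt (j : 'I_k.+1) : u %/ d * d + 2 * j < n.
  have := leq_mul ltq (leqnn d); have := leq_trunc_div n d.
  by have := jlt j; rewrite mulSn; lia.
pose w j := Ordinal (wlt j).
have wdiv j : w j %/ d = u %/ d by rewrite divnMDl // (divn_small (jlt j)) addn0.
have wz j : block_label k n (w j) = 0.
  by rewrite /block_label -/d wdiv ltq modnMDl modn_small // mul2n odd_double.
have winj : injective w by move=> i j /(congr1 val) /= e; apply: val_inj => /=; lia.
have [sP|/subsetPn[x /imsetP[j _ ->] xP]] := boolP ([set w j | j in 'I_k.+1] \subset P).
  by have := subset_leq_card sP; rewrite card_imset // card_ord cP ltnn.
exists (w j); rewrite wdiv wz xP !eqxx andbT /=.
by rewrite {1}(divn_eq u d) ud; lia.
Qed.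

Definition block_labeling (k n : nat) : labeling (path_graph n) k :=
  [ffun i : 'I_n => inord (block_label k n i)].

(** Here the maximum degree and [k] are positive, so the label 2 is admissible and [inord] changes
    nothing. *)
Lemma block_labelingE (k n : nat) (i : 'I_n) :
  2 <= k <= n -> block_labeling k n i = block_label k n i :> nat.
Proof.
move=> /andP[hk kn]; rewrite ffunE inordK //.
have := max_degree_path_gt0 (leq_trans hk kn).
by have := block_label_le2 k n i; lia.
Qed.

Lemma block_labeling_proper (k n : nat) :
  2 <= k <= n -> proper_kSRD (block_labeling k n).
Proof.
move=> hkn; apply/forallP => P; apply/implyP => /eqP cP; apply/existsP.
set d := 2 * k + 1; have dgt0 : 0 < d by lia.
(* Some unattacked zero lies strictly to the right of [u] in its block. *)
pose spared (u : 'I_n) := [exists w : 'I_n,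
  [&& u < w, w %/ d == u %/ d, block_label k n w == 0 & w \notin P]].
(* The default of [insubd] is never reached: a spared zero to the right keeps [u.+1] in range. *)
pose delta := [ffun u : 'I_n => insubd u (if spared u then u.+1 else u.-1)].
have deltaR u : spared u -> delta u = u.+1 :> nat.
  move=> sp; rewrite ffunE sp val_insubd; case: ifP => //.
  by have /existsP[w /and4P[]] := sp; have := ltn_ord w; lia.
have deltaL u : ~~ spared u -> delta u = u.-1 :> nat.
  by move=> /negbTE sp; rewrite ffunE sp val_insubd; have := ltn_ord u; case: ifP; lia.
exists delta; apply/andP; split.
  apply/forall_inP => u; rewrite !inE block_labelingE // => /andP[uP /eqP u0].
  suff [adj_u div_u] : path_adj u (delta u) /\ delta u %/ d = u %/ d.
    apply/andP; split; first exact: adj_u.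
    by rewrite block_labelingE // (block_label_adjacent adj_u div_u u0).
  have [sp|nsp] := boolP (spared u).
    rewrite /path_adj deltaR // eqxx; split => //.
    have /existsP[w /and4P[uw /eqP wd _ _]] := sp.
    by apply: (divn_between (l := w)) => //; lia.
  (* An attacked first zero of a block has a spared zero to its right, so a zero defended from the
     left has its left neighbour in the same block. *)
  have ud : 0 < u %% d.
    rewrite lt0n; apply: contra nsp => /eqP ud.
    have [w /and4P[uw wd w0 wP]] := block_zero_spared cP u0 ud.
    apply/existsP; exists w; rewrite ltn_neqAle uw wd w0 wP /= !andbT.
    by apply: contraNneq wP => /val_inj <-.
  have ugt0 : 0 < u by apply: leq_trans ud (leq_mod u d).
  rewrite /path_adj deltaL // prednK // eqxx orbT; split => //.
  by rewrite -[in RHS](prednK ugt0) divnS // prednK // /dvdn gtn_eqF.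
apply/forallP => v; apply/implyP; rewrite !block_labelingE // => v2.
apply: (@leq_trans 1); last lia.
apply/card_le1_eqP.
have uniq_lt u1 u2 : u1 \in zeros (block_labeling k n) P ->
    u2 \in zeros (block_labeling k n) P ->
    delta u1 = v -> delta u2 = v -> u1 < u2 -> False.
  rewrite !inE !block_labelingE // => /andP[u1P /eqP z1] /andP[u2P /eqP z2].
  move=> d1 d2 lt12.
  have sp1 : spared u1.
    have [//|/deltaL] := boolP (spared u1); rewrite d1 => vE.
    have [/deltaR|/deltaL] := boolP (spared u2); rewrite d2; first lia.
    (* If both are defended from the left, equal predecessors of distinct numbers force [u1 = 0],
       where [.-1] truncates. *)
    move=> vE2; have v0 : v = u1 :> nat by lia.
    by move: v2; rewrite v0 z1.
  have := deltaR _ sp1; rewrite d1 => vE.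
  have [/deltaR|nsp2] := boolP (spared u2); first by rewrite d2; lia.
  have := deltaL _ nsp2; rewrite d2 => vE2.
  (* Now [u1] and [u2] are the two neighbours of [v]. The spared zero [w] beyond [u1] is neither [v]
     nor [u2], so it lies beyond [u2] and makes [u2] spared. *)
  have /existsP[w /and4P[uw /eqP wd w0 wP]] := sp1.
  have nwv : w != v :> nat by apply: contraTneq v2 => <-; rewrite (eqP w0).
  have nwu2 : w != u2 :> nat by apply: contraNneq wP => /val_inj ->.
  move/negP: nsp2; apply; apply/existsP; exists w.
  rewrite w0 wP wd (@divn_between d u1 u2 w) ?eqxx //; lia.
move=> u1 u2 /setIdP[z1 /eqP d1] /setIdP[z2 /eqP d2].
have [lt|lt|/ord_inj//] := ltngtP (nat_of_ord u1) (nat_of_ord u2).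
  by case: (uniq_lt u1 u2).
by case: (uniq_lt u2 u1).
Qed.

Lemma weight_block_labeling (k n : nat) :
  2 <= k <= n -> weight (block_labeling k n) + n %/ (2 * k + 1) = n.
Proof.
move=> hkn; rewrite -[RHS](sum_block_label k n); congr (_ + _).
by rewrite big_mkord; apply: eq_bigr => i _; rewrite block_labelingE.
Qed.

Lemma ceil_proportion (k n : nat) :
  Num.ceil ((2 * k)%N%:R / (2 * k + 1)%N%:R * n%:R : rat)%R
    = Posz (n - n %/ (2 * k + 1)).
Proof.
set d := 2 * k + 1.
have d0 : (0 < d%:R :> rat)%R by rewrite ltr0n; lia.
have e1 := divn_eq n d; have e2 : n %% d < d by rewrite ltn_mod; lia.
have e3 : n %/ d <= n by exact: leq_div.
apply: ceil_def.
(* Clearing the denominator turns the two bounds defining the ceiling into inequalities between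
   naturals. *)
rewrite mulrAC ltr_pdivlMr // ler_pdivrMr // rmorphB rmorph1 mulrBl mul1r.
rewrite ltrBlDr -!natrM -!natrD ltr_nat ler_nat.
set q := n %/ d in e1 e3 *; rewrite /d in e1 e2 *.
by apply/andP; split; nia.
Qed.

Theorem theorem3 (k n : nat) (hk : (2 <= k)%N) (hn : (k <= n)%N) :
  Posz (gamma_kSRD k (path_graph n)) =
  Num.ceil ((2 * k)%N%:R / (2 * k + 1)%N%:R * n%:R : rat)%R.
Proof.
rewrite ceil_proportion; congr Posz.
have hkn : 2 <= k <= n by rewrite hk.
have [[f fP <-] gmin] := gamma_kSRD_min k (path_graph n).
have := gmin _ (block_labeling_proper hkn).
by have := weight_block_labeling hkn; have := weight_path_ge hn fP; lia.
Qed.
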